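(* For a fixed integer $r\geq1$, the set $\{\varepsilon(r,s,p) : s\ge r \text{ an integer},\ p \text{ a prime}\}$ has at most $2^{r-1}$ elements.
   Context: For a positive integer $n$, let $J_n$ denote the $n\times n$ matrix with $1$s in positions $(i,i)$ for $1\le i\le n$ and $(i,i+1)$ for $1\le i<n$, and $0$s elsewhere. For $1\le r\le s$ and a field $F$ of prime characteristic $p$, the Jordan canonical form of $J_r\otimes J_s$ over $F$ is $J_{\lambda_1}\oplus\cdots\oplus J_{\lambda_r}$ with $\lambda_1\ge\cdots\ge\lambda_r>0$; write $\lambda(r,s,p)=(\lambda_1,\dots,\lambda_r)$ (depending only on $r,s,p$). The deviation vector is $\varepsilon(r,s,p)=(\lambda_1-s,\dots,\lambda_r-s)$. *)

(* Defs.v *)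
From mathcomp Require Import all_boot all_order all_algebra.
Set Implicit Arguments. Unset Strict Implicit. Unset Printing Implicit Defensive.
Import GRing.Theory Num.Theory.
Local Open Scope ring_scope.

Definition jent (a c : nat) : bool := (a == c) || (c == a.+1).

Definition jordan1 (F : nzRingType) (n : nat) : 'M[F]_n :=
  \matrix_(i < n, j < n) (jent i j)%:R.

(* The Kronecker product J_r (x) J_s, an (r*s) x (r*s) matrix: with the
   standard ordering of the tensor basis, row index a*s+b and column index
   c*s+d (a,c < r ; b,d < s) carry the entry (J_r)_{a c} * (J_s)_{b d}. *)
Definition jordan_tensor (F : nzRingType) (r s : nat) : 'M[F]_(r * s) :=
  \matrix_(i < r * s, j < r * s)
    ((jent (i %/ s) (j %/ s))%:R * (jent (i %% s) (j %% s))%:R).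

(* Block starting positions (other than 0) of J_{lam_1} (+) ... (+) J_{lam_k}:
   the partial sums lam_1, lam_1+lam_2, ... *)
Definition block_cuts (lam : seq nat) : seq nat :=
  [seq sumn (take k lam) | k <- iota 1 (size lam)].

(* The block diagonal matrix J_{lam_1} (+) ... (+) J_{lam_k} as an n x n
   matrix (meaningful when sumn lam = n). *)
Definition jordan_sum (F : nzRingType) (n : nat) (lam : seq nat) : 'M[F]_n :=
  \matrix_(i < n, j < n)
    (((i : nat) == j) || (((j : nat) == i.+1) && (i.+1 \notin block_cuts lam)))%:R.

Definition similar (F : fieldType) (n : nat) (A B : 'M[F]_n) : Prop :=
  exists2 P : 'M[F]_n, P \in unitmx & A *m P = P *m B.

Definition is_lambda (r s p : nat) (lam : seq nat) : Prop :=
  [/\ sorted geq lam, all (fun x => 0 < x)%N lam, sumn lam = (r * s)%N &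
      similar (jordan_tensor 'F_p r s) (jordan_sum 'F_p (r * s) lam)].

Definition deviation (s : nat) (lam : seq nat) : seq int :=
  [seq (x%:Z - s%:Z)%R | x <- lam].

(* Main.v *)
Require Import Defs.
From HB Require Import structures.
From mathcomp Require Import all_boot all_order all_algebra.
From mathcomp Require Import ring zify.

(** Over a field, the rows of [J_r (x) J_s] carry the graded ring
    V = F[u, y] / (u^r, y^s), on which W = J_r (x) J_s - 1 acts as the linear
    form u + y.  The ideal (u^r, y^s) : W^m contains two coprime forms of
    degrees (a_m, b_m): going from m to m + 1, a suitable combination of the
    two forms is divisible by W, and dividing lowers one of the degrees by 1,
    while rank(W^m) - rank(W^(m+1)) is at most the other degree, i.e. at most
    a_m b_m - a_(m+1) b_(m+1).  These bounds add up to r s = rank(W^0), so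
    rank(W^m) = a_m b_m = \sum_i max(lam_i - m, 0).  The number
    a_m b_m - a_(m+1) b_(m+1) of parts exceeding m cannot increase with m, hence
    a degree pair leaving the diagonal at (n, n) first lowers one coordinate to
    some q < n and then the other one, down to (q, q); this contributes n - q
    parts equal to r + s - n - q.  So the deviation vector is determined by
    the diagonal points visited between (r, r) and (0, 0), i.e. by a subset
    of {1, ..., r - 1}. *)

Set Implicit Arguments.
Unset Strict Implicit.
Unset Printing Implicit Defensive.
Import GRing.Theory.

(** * Ranks of Jordan matrices *)

Lemma block_cuts_cons x l :
  block_cuts (x :: l) = x :: [seq x + c | c <- block_cuts l].
Proof.
rewrite /block_cuts /= take0 /= addn0; congr (_ :: _).
by rewrite -[2]/(1 + 1) iotaDl -!map_comp; apply: eq_map.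
Qed.

(** Row [i] of the [t]-th power of the nilpotent part survives exactly when no block boundary lies
    in [i+1..i+t], so that the shift by [t] stays in one block. *)
Definition uncut (cuts : seq nat) t i := all (fun k => i + k \notin cuts) (iota 1 t).

Lemma uncutS cuts t i :
  uncut cuts t.+1 i = uncut cuts t i && ((i + t).+1 \notin cuts).
Proof. by rewrite /uncut -{1}[t.+1]addn1 iotaD all_cat /= andbT add1n addnS. Qed.

Lemma uncut_consl x l t i : i < x ->
  uncut (block_cuts (x :: l)) t i && (i + t < x + sumn l) = (i + t < x).
Proof.
move=> lt_ix; rewrite block_cuts_cons; apply/andP/idP => [[/allP uc _]|lt_itx].
  rewrite ltnNge; apply/negP=> le_x.
  have: x - i \in iota 1 t by rewrite mem_iota; lia.
  by move/uc; rewrite subnKC ?mem_head // ltnW.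
split; last by lia.
apply/allP=> k; rewrite mem_iota inE => /andP[k_gt0 le_kt].
apply/negP=> /predU1P[|/mapP[c _]]; lia.
Qed.

Lemma uncut_consr x l t i :
  uncut (block_cuts (x :: l)) t (i + x) = uncut (block_cuts l) t i.
Proof.
rewrite block_cuts_cons; apply: eq_in_all => k.
rewrite mem_iota => /andP[k_gt0 _]; rewrite inE -addnA addnCA.
rewrite -{2}[x]addn0 eqn_add2l (_ : (i + k == 0) = false); last by lia.
by rewrite mem_map //; apply: addnI.
Qed.

Lemma count_uncut lam t :
  \sum_(0 <= i < sumn lam)
     (uncut (block_cuts lam) t i && (i + t < sumn lam)) =
  \sum_(x <- lam) (x - t).
Proof.
elim: lam => [|x l IHl]; first by rewrite big_geq // big_nil.
rewrite big_cons -IHl (@big_cat_nat _ _ _ x) ?leq_addr //=; congr (_ + _).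
  rewrite big_nat (eq_bigr (fun i => nat_of_bool (i + t < x))) => [|i /andP[_ ?]].
    rewrite -big_nat; elim: x => [|x IHx]; first by rewrite big_geq.
    rewrite big_nat_recl // (eq_bigr (fun i => nat_of_bool (i + t < x))) //.
    rewrite IHx; lia.
  by rewrite uncut_consl.
rewrite -{1}[x]add0n big_addn addKn; apply: eq_bigr => i _.
by rewrite uncut_consr; congr (nat_of_bool (_ && _)); lia.
Qed.

Section JordanSumRank.
Local Open Scope ring_scope.
Variables (F : fieldType) (n : nat).

Lemma jordan_sum_pow lam t :
  (jordan_sum F n lam - 1) ^+ t =
  \matrix_(i, j) (uncut (block_cuts lam) t i && (j == i + t :> nat)%N)%:R.
Proof.
elim: t => [|t IHt].
  by apply/matrixP=> i j; rewrite expr0 !mxE /= addn0 eq_sym.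
rewrite exprSr IHt; apply/matrixP=> i j; rewrite !mxE uncutS.
under eq_bigr do rewrite !mxE.
have [lt_itn|le_nit] := ltnP (i + t) n; last first.
  rewrite big1 => [|k _]; last first.
    rewrite (_ : (k == i + t :> nat)%N = false) ?andbF ?mul0r //.
    by have := ltn_ord k; lia.
  rewrite (_ : (j == i + t.+1 :> nat)%N = false) ?andbF //.
  by have := ltn_ord j; lia.
rewrite (bigD1 (Ordinal lt_itn)) //= eqxx andbT big1 => [|k ne_k]; last first.
  rewrite (_ : (k == i + t :> nat)%N = false) ?andbF ?mul0r //.
  by apply/negbTE.
rewrite addr0 -[_ == j]/(i + t == j :> nat)%N addnS.
have [<-|ne] := eqVneq (i + t)%N j; first by rewrite subrr mulr0 ltn_eqF ?andbF.
rewrite subr0 -natrM mulnb; congr (nat_of_bool _)%:R.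
by rewrite -andbA; congr (_ && _); rewrite andbC.
Qed.

(** The nonzero rows are distinct unit vectors; [B] collects them, and [B *m B^T = 1] bounds the
    rank from below. *)
Lemma rank_shift_mx (P : pred 'I_n) t :
  \rank (\matrix_(i, j) (P i && (j == i + t :> nat)%N)%:R : 'M[F]_n) =
  #|[pred i | P i & (i + t < n)%N]|.
Proof.
set A := \matrix_(i, j) _; set Q := [pred i | _ & _].
pose B : 'M[F]_(#|Q|, n) := \matrix_(k < #|Q|) row (enum_val k) A.
have BA : (B <= A)%MS by apply/row_subP=> k; rewrite rowK row_sub.
have AB : (A <= B)%MS.
  apply/row_subP=> i; have [Qi|nQi] := boolP (i \in Q).
    by rewrite -[i](enum_rankK_in Qi Qi) -(rowK (fun k => row (enum_val k) A)) row_sub.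
  rewrite (_ : row i A = 0) ?sub0mx //; apply/rowP=> j; rewrite !mxE.
  move: nQi; rewrite inE negb_and -leqNgt => /orP[/negbTE->//|le_n].
  by rewrite (_ : (j == i + t :> nat)%N = false) ?andbF //; have := ltn_ord j; lia.
have BBt : B *m B^T = 1%:M.
  apply/matrixP=> k l; rewrite !mxE.
  have /andP[Pk ltk] := enum_valP k; have /andP[Pl _] := enum_valP l.
  rewrite (bigD1 (Ordinal ltk)) //= !mxE Pk Pl /= eqxx mul1r big1 ?addr0.
    by rewrite eqn_add2r -[_ == _ :> nat]/(enum_val k == enum_val l) (inj_eq enum_val_inj).
  move=> j ne_j; rewrite !mxE (_ : (j == enum_val k + t :> nat)%N = false) ?andbF ?mul0r //.
  by apply/negbTE.
apply/eqP; rewrite eqn_leq (leq_trans (mxrankS AB) (rank_leq_row _)) /=.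
apply: leq_trans (mxrankS BA); apply: (@leq_trans (\rank (B *m B^T))); first by rewrite BBt mxrank1.
exact: mxrankM_maxl.
Qed.

Lemma rank_jordan_sum lam t : sumn lam = n ->
  \rank ((jordan_sum F n lam - 1) ^+ t) = (\sum_(x <- lam) (x - t))%N.
Proof.
move=> sum_lam; rewrite jordan_sum_pow rank_shift_mx -count_uncut sum_lam.
by rewrite big_mkord -sum1_card big_mkcond.
Qed.

Lemma rank_similar_pow (A B : 'M[F]_n) t : Defs.similar A B ->
  \rank ((A - 1) ^+ t) = \rank ((B - 1) ^+ t).
Proof.
case=> P uP AP.
have: (A - 1) ^+ t *m P = P *m (B - 1) ^+ t.
  elim: t => [|t IHt]; first by rewrite !expr0 mul1mx mulmx1.
  have AP1 : (A - 1) *m P = P *m (B - 1).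
    by rewrite mulmxBl mulmxBr AP mul1mx mulmx1.
  by rewrite !exprS -!mulmxE -mulmxA IHt !mulmxA AP1.
move/(congr1 mxrank); rewrite mxrankMfree ?row_free_unit // => ->.
by rewrite eqmxMfull // row_full_unit.
Qed.

End JordanSumRank.

(** * Annihilating forms of the tensor product *)

Section TensorForms.
Local Open Scope ring_scope.
Variables (F : fieldType) (r s : nat).
Hypothesis s_gt0 : (0 < s)%N.

Local Notation W := (jordan_tensor F r s - 1).

Lemma sum_divn_modn (G : nat -> nat -> F) :
  \sum_(k < r * s) G (k %/ s)%N (k %% s)%N = \sum_(a < r) \sum_(b < s) G a b.
Proof.
rewrite -(big_mkord xpredT (fun k => G (k %/ s)%N (k %% s)%N)) big_nat_mul.
rewrite big_mkord; apply: eq_bigr => a _.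
rewrite -{1}[(a * s)%N]add0n big_addn mulSn addnK big_mkord.
apply: eq_bigr => b _.
by rewrite addnC divnMDl // modnMDl divn_small // modn_small // addn0.
Qed.

Lemma sum_jent m c (g : nat -> F) : (c < m)%N ->
  \sum_(a < m) g a * (jent a c)%:R = g c + (if c is c'.+1 then g c' else 0).
Proof.
move=> lt_cm.
have E (a : 'I_m) : g a * (jent a c)%:R
    = g a * (nat_of_ord a == c)%:R + g a * (c == a.+1)%:R.
  rewrite /jent -mulrDr; congr (_ * _).
  have [->|_] := eqVneq (nat_of_ord a) c.
    by rewrite /= (ltn_eqF (ltnSn c)) addr0.
  by rewrite add0r.
rewrite (eq_bigr _ (fun a _ => E a)) big_split /=; congr (_ + _).
  rewrite (bigD1 (Ordinal lt_cm)) //= eqxx mulr1 big1 ?addr0 // => a ne_a.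
  by rewrite (_ : (a == c :> nat) = false) ?mulr0 //; apply/negbTE.
case: c lt_cm {E} => [|c] lt_cm; first by apply: big1 => a _; rewrite mulr0.
rewrite (bigD1 (Ordinal (ltnW lt_cm))) //= eqxx mulr1 big1 ?addr0 // => a ne_a.
rewrite (_ : (c.+1 == a.+1) = false) ?mulr0 //; apply/negbTE.
by rewrite eqSS eq_sym.
Qed.

(* With u := (J_r - 1) (x) J_s and y := 1 (x) (J_s - 1), the row space is
   F[u, y] / (u^r, y^s) and W = u + y is homogeneous.  [form d h] is the class
   of the form of degree d with dehomogenisation h, i.e. of
   \sum_i h_i u^i y^(d - i), meaningful when size h <= d + 1. *)
Definition form (d : nat) (h : {poly F}) : 'rV[F]_(r * s) :=
  \row_k (h`_(k %/ s) *: ((1 + 'X) ^+ (k %/ s) * 'X^(d - k %/ s)))`_(k %% s).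

Lemma form_is_linear d : linear (form d).
Proof.
move=> c h k; apply/rowP=> j; rewrite !mxE !coefZ !coefE; ring.
Qed.

HB.instance Definition _ d :=
  GRing.isLinear.Build F {poly F} 'rV[F]_(r * s) _ (form d) (form_is_linear d).

Lemma form_mulW d (h : {poly F}) : (size h <= d.+1)%N ->
  form d h *m W = form d.+1 (('X + 1) * h).
Proof.
move=> sh; apply/rowP=> l.
have lt_c : (l %/ s < r)%N by rewrite ltn_divLR.
have lt_e : (l %% s < s)%N by rewrite ltn_mod.
pose q a : {poly F} := h`_a *: ((1 + 'X) ^+ a * 'X^(d - a)).
have -> : form d h *m W = form d h *m jordan_tensor F r s - form d h.
  by rewrite mulmxBr mulmx1.
rewrite !mxE -/(q _).
under eq_bigr do rewrite !mxE -/(q _).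
rewrite (sum_divn_modn (fun a b => (q a)`_b *
  ((jent a (l %/ s))%:R * (jent b (l %% s))%:R))).
move: (l %/ s)%N (l %% s)%N lt_c lt_e => c e lt_c lt_e.
have Es a : \sum_(b < s) (q a)`_b * ((jent a c)%:R * (jent b e)%:R)
    = ((1 + 'X) * q a)`_e * (jent a c)%:R.
  under eq_bigr do rewrite mulrCA mulrC.
  rewrite -big_distrl /= (sum_jent (fun b => (q a)`_b)) //; congr (_ * _).
  by rewrite mulrDl mul1r coefD coefXM; case: (e).
under eq_bigr do rewrite Es.
rewrite (sum_jent (fun a => ((1 + 'X) * q a)`_e)) //.
transitivity (((1 + 'X) * q c +
    (if c is c'.+1 then (1 + 'X) * q c' else 0) - q c)`_e).
  by rewrite coefB (@coefD F); case: (c) => [|?] //; rewrite coef0.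
apply: (congr1 (fun p : {poly F} => p`_e)).
rewrite [('X + 1) * h]mulrDl mul1r (@coefD F) coefXM scalerDl [RHS]addrC.
have -> X : (1 + 'X) * q c + X - q c = 'X * q c + X by ring.
congr (_ + _).
  rewrite /q; have [le_cd|lt_dc] := leqP c d.
    by rewrite subSn // -scalerAr exprS; congr (_ *: _); ring.
  by rewrite nth_default ?scale0r ?mulr0 // (leq_trans sh).
case: c {lt_c Es} => [|c]; first by rewrite scale0r.
by rewrite /q subSS /= -scalerAr exprS mulrA.
Qed.

(** The classes of the monomials [u^a y^b] are the rows of [M], which is unitriangular and hence
    invertible. This reduces inclusions of row spaces to homogeneous elements. *)
Lemma form_spans m p (Q : 'M[F]_(r * s, m)) (A : 'M[F]_(p, m)) :
  (forall d (e : {poly F}), (size e <= d.+1)%N -> (form d e *m Q <= A)%MS) -> (Q <= A)%MS.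
Proof.
move=> QA.
pose M : 'M[F]_(r * s) := \matrix_k form (k %/ s + k %% s) 'X^(k %/ s).
have ME k l : M k l = ((l %/ s)%N == (k %/ s)%N)%:R *
    ((1 + 'X) ^+ (k %/ s) * 'X^(k %% s))`_(l %% s).
  rewrite !mxE coefZ coefXn; have [->|_] := eqVneq; last by rewrite !mul0r.
  by rewrite addKn.
have trigM : is_trig_mx M^T.
  apply/is_trig_mxP=> i j lt_ij; rewrite mxE ME.
  have [eq_d|_] := eqVneq; last by rewrite mul0r.
  rewrite coefMXn ifT ?mulr0 // -(ltn_add2l (i %/ s * s)) -divn_eq {1}eq_d.
  by rewrite -divn_eq.
have detM : \det M = 1.
  rewrite -det_tr (det_trig trigM) big1 // => i _.
  rewrite mxE ME eqxx mul1r coefMXn ltnn subnn.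
  by rewrite -horner_coef0 !hornerE expr1n.
have uM : M \in unitmx by rewrite unitmxE detM unitr1.
rewrite -(mulKmx uM Q) (submx_trans (submxMl _ _)) //.
apply/row_subP=> i; rewrite row_mul rowK QA // size_polyXn ltnS leq_addr //.
Qed.

(** * The homogeneous colon ideals [(u^r, y^s) : W^m] *)

Definition annih m a (h : {poly F}) := forall c (e : {poly F}),
  (size e <= c.+1)%N -> form (a + c) (h * e) *m W ^+ m = 0.

Lemma annihS m a h : annih m a h -> annih m.+1 a h.
Proof.
by move=> Ih c e se; rewrite exprSr mulmxA Ih // mul0mx.
Qed.

Lemma annih_divW m a (h : {poly F}) : (size h <= a.+1)%N ->
  annih m a.+1 (('X + 1) * h) -> annih m.+1 a h.
Proof.
move=> sh Ih c e se; rewrite exprS mulmxA form_mulW ?mulrA ?Ih //.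
apply: leq_trans (size_polyMleq _ _) _; lia.
Qed.

Lemma annih_Xr : annih 0 r 'X^r.
Proof.
move=> c e _; rewrite mulmx1; apply/rowP=> k; rewrite !mxE coefXnM.
by rewrite ltn_divLR // ltn_ord scale0r coef0.
Qed.

Lemma annih_ys : annih 0 s 1.
Proof.
move=> c e se; rewrite mul1r mulmx1; apply/rowP=> k; rewrite !mxE coefZ.
have [lt_ck|le_kc] := ltnP c (k %/ s)%N.
  by rewrite nth_default ?mul0r // (leq_trans se).
rewrite coefMXn ifT ?mulr0 // (@leq_trans s) ?ltn_mod //; lia.
Qed.

Lemma XD1_factor (h : {poly F}) : h.[-1] = 0 -> {k | h = ('X + 1) * k}.
Proof.
move=> h0; exists (h %/ ('X - (-1)%:P)).
have: 'X - (-1)%:P %| h by rewrite dvdp_XsubCl /root h0.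
by move/divpK => {1}<-; rewrite mulrC polyCN opprK.
Qed.

Lemma size_XD1M (k : {poly F}) : k != 0 -> size (('X + 1) * k) = (size k).+1.
Proof.
move=> nz; have s2 : size ('X + 1 : {poly F}) = 2%N by rewrite -polyC1 size_XaddC.
by rewrite size_mul -?size_poly_gt0 ?s2 // size_poly_gt0.
Qed.

Lemma size_XD1M_leq (k : {poly F}) a :
  (size (('X + 1) * k)%R <= a.+1)%N -> (size k <= a)%N.
Proof.
have [->|nz] := eqVneq k 0; first by rewrite size_poly0.
by rewrite size_XD1M.
Qed.

(** Modulo [W], a form of degree [d] is a scalar multiple of [y^d], and for [d >= c] also of
    [h y^(d - c)], which [W^m] kills. So the [c] vectors [y^d W^m] with [d < c] span the image of
    [W^m] modulo that of [W^(m+1)]. *)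
Lemma rank_step m c (h : {poly F}) :
  (size h <= c.+1)%N -> annih m c h -> h.[-1] != 0 ->
  (\rank (W ^+ m) <= c + \rank (W ^+ m.+1))%N.
Proof.
move=> sh Ih nz.
pose B : 'M[F]_(c, r * s) := \matrix_(d < c) (form d 1 *m W ^+ m).
suff: (W ^+ m <= B + W ^+ m.+1)%MS.
  move/mxrankS/leq_trans; apply; apply: leq_trans (mxrank_adds_leqif _ _) _.
  by rewrite leq_add2r rank_leq_row.
have divisible d (e : {poly F}) : (size e <= d.+1)%N -> e.[-1] = 0 ->
    (form d e *m W ^+ m <= B + W ^+ m.+1)%MS.
  move=> se /XD1_factor[k ek]; rewrite {}ek in se *.
  have sk := size_XD1M_leq se.
  case: d se sk => [|d] se sk.
    move: sk; rewrite leqn0 size_poly_eq0 => /eqP->.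
    by rewrite mulr0 linear0 mul0mx sub0mx.
  rewrite -form_mulW // -mulmxA mulmxE -exprS.
  by rewrite (submx_trans (submxMl _ _)) ?addsmxSr.
apply: form_spans => d e se; have [lt_dc|le_cd] := ltnP d c.
  rewrite -[e](subrK (e.[-1] *: 1)) linearD /= [form d (_ *: _)]linearZ /= mulmxDl addmx_sub //.
    apply: divisible; last by rewrite hornerD hornerN hornerZ hornerC mulr1 subrr.
    rewrite (leq_trans (size_polyD _ _)) // geq_max se size_polyN.
    by rewrite (leq_trans (size_scale_leq _ _)) ?size_poly1.
  rewrite -scalemxAl scalemx_sub // (submx_trans _ (addsmxSl _ _)) //.
  by rewrite (_ : _ *m _ = row (Ordinal lt_dc) B) ?row_sub // rowK.
pose q := e.[-1] / h.[-1].
rewrite -[e](subrK (q *: h)) linearD /= [form d (_ *: _)]linearZ /= mulmxDl addmx_sub //.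
  apply: divisible; last by rewrite hornerD hornerN hornerZ divfK ?subrr.
  rewrite (leq_trans (size_polyD _ _)) //.
  rewrite geq_max se size_polyN (leq_trans (size_scale_leq _ _)) //.
  by rewrite (leq_trans sh).
rewrite -scalemxAl scalemx_sub //; have := Ih (d - c)%N 1.
by rewrite size_poly1 mulr1 subnKC // => -> //; rewrite sub0mx.
Qed.


(** Coprimality of the dehomogenisations leaves only [y] as a possible common factor of the two
    forms; the condition that one size is maximal excludes it. *)
Definition form_state m a b := exists h k : {poly F},
  [/\ coprimep h k, ((size h <= a.+1) && (size k <= b.+1))%N,
      (size h == a.+1) || (size k == b.+1), annih m a h & annih m b k].

Lemma form_stateC m a b : form_state m a b -> form_state m b a.
Proof.
by case=> h [k [cop sz top Ih Ik]]; exists k, h; rewrite coprimep_sym andbC orbC.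
Qed.

(** Subtracting [c h y^(b + 1 - a)] from [k] makes it vanish at -1, hence divisible by [W]; the
    factor [y] is invisible after dehomogenisation. *)
Lemma form_state_reduce m a b (h k : {poly F}) : (a <= b.+1)%N ->
  coprimep h k -> (size h <= a.+1)%N -> (size k <= b.+2)%N ->
  (size h == a.+1) || (size k == b.+2) ->
  annih m a h -> annih m b.+1 k -> h.[-1] != 0 -> form_state m.+1 a b.
Proof.
move=> le_ab cop sh sk top Ih Ik nz.
pose c := k.[-1] / h.[-1].
have [|k' ek] := @XD1_factor (k - c *: h); first by rewrite hornerD hornerN hornerZ divfK ?subrr.
have sch : (size (c *: h) <= a.+1)%N by apply: leq_trans (size_scale_leq _ _) _.
have sk1 : (size (('X + 1) * k')%R <= b.+2)%N.
  rewrite -ek (leq_trans (size_polyD _ _)) // geq_max sk size_polyN.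
  by rewrite (leq_trans sch).
have sk' := size_XD1M_leq sk1.
exists h, k'; split=> //; last 2 first.
- exact: annihS.
- apply: annih_divW => //; rewrite -ek => d e se.
  rewrite mulrBl linearB mulmxBl Ik // -scalerAl linearZ -scalemxAl.
  rewrite -(subnKC le_ab) -addnA Ih ?scaler0 ?subr0 //; lia.
- have: coprimep h (('X + 1) * k').
    by rewrite -ek -(coprimep_addl_mul c%:P) mul_polyC addrC subrK.
  by rewrite coprimepMr => /andP[].
- by rewrite sh.
case/orP: top => [->//|/eqP sk_top].
(* When [h] falls short of full size, [c *: h] cannot reach the top coefficient of [k], which
   therefore passes to the quotient [k']. *)
have [sh_lt|sh_top] := ltnP (size h) a.+1; last by rewrite eqn_leq sh sh_top.
have sk1_top : size (('X + 1) * k') = b.+2.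
  rewrite -ek size_polyDl // size_polyN sk_top.
  apply: leq_ltn_trans (size_scale_leq _ _) _.
  by apply: leq_trans sh_lt _; rewrite ltnS.
suff nzk' : k' != 0.
  by apply/orP; right; rewrite -eqSS -(size_XD1M nzk') sk1_top.
by apply/eqP => k'0; move: sk1_top; rewrite k'0 mulr0 size_poly0.
Qed.

(** If [W] does not divide [h], reduction lowers [b] and [h] gives the rank bound. Otherwise
    coprimality keeps [W] from dividing [k], so dividing [h] lowers [a] and [k] gives the bound.
    Either bound is exactly the drop of [a * b]. *)
Lemma form_state_step m a b : form_state m a b -> (a <= b)%N -> (0 < b)%N ->
  (form_state m.+1 a b.-1 /\ (\rank (W ^+ m) <= a + \rank (W ^+ m.+1))%N) \/
  [/\ (0 < a)%N, form_state m.+1 a.-1 b &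
      (\rank (W ^+ m) <= b + \rank (W ^+ m.+1))%N].
Proof.
case=> h [k [cop /andP[sh sk] top Ih Ik]]; case: b sk top Ik => // b sk top Ik.
move=> le_ab _; have [h0|nz] := eqVneq h.[-1] 0; last first.
  left; split; last exact: rank_step Ih nz.
  exact: form_state_reduce Ih Ik nz.
right; have k_nz : k.[-1] != 0.
  by rewrite (coprimep_root cop) // /root h0.
have [h' eh] := XD1_factor h0; subst h; have sh' := size_XD1M_leq sh.
(* For [a = 0] the multiple of ['X + 1] must be zero; then [k] is a nonzero constant by coprimality,
   too small for the maximal-size condition. *)
case: a sh top Ih le_ab sh' => [|a] sh top Ih le_ab sh'.
  move: sh' cop top; rewrite leqn0 size_poly_eq0 => /eqP->.
  rewrite mulr0 coprime0p -size_poly_eq1 => /eqP->.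
  by rewrite size_poly0.
split=> //; last exact: rank_step Ik k_nz.
exists h', k; split=> //.
- by move: cop; rewrite coprimepMl => /andP[].
- by rewrite sh'.
- move: top; have [->|nz] := eqVneq h' 0; first by rewrite mulr0 size_poly0.
  by rewrite size_XD1M.
- exact: annih_divW.
- exact: annihS.
Qed.

Lemma form_state_rank m a b : form_state m a b -> (\rank (W ^+ m) <= a * b)%N.
Proof.
have [n le_n] := ubnP (a + b)%N; elim: n => // n IHn in m a b le_n *.
wlog le_ab: a b le_n / (a <= b)%N => [hw|].
  case/orP: (leq_total a b) => le st; first by apply: hw.
  by rewrite (mulnC a); apply: hw; rewrite 1?addnC //; apply: form_stateC.
move=> st; case: b le_ab le_n st => [|b] le_ab le_n st.
  move: le_ab st; rewrite leqn0 => /eqP-> st.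
  (* Both degrees are 0 here, so one of the forms is a nonzero constant and [W^m] vanishes. *)
  wlog [h nz [sh Ih]] : / exists2 h : {poly F}, h != 0 & (size h <= 1)%N /\ annih m 0 h.
    case: st => h [k [cop /andP[sh sk] top Ih Ik]]; apply.
    by case/orP: top => /eqP sz; [exists h | exists k]; rewrite // -size_poly_gt0 sz.
  have [x eh] : exists x, h = x%:P by exists h`_0; apply: size1_polyC.
  rewrite {}eh polyC_eq0 in nz Ih.
  rewrite leqn0 mxrank_eq0 -submx0; apply: form_spans => d e se.
  have := Ih d (x^-1 *: e); rewrite mul_polyC scalerA divff // scale1r.
  by rewrite size_scale ?invr_eq0 // add0n => -> //; rewrite sub0mx.
have [//||[st1 le1]|[a_gt0 st1 le1]] := form_state_step st; first by [].
  by rewrite mulnS (leq_trans le1) // leq_add2l IHn //; lia.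
case: a a_gt0 le_ab le_n st st1 le1 => // a _ le_ab le_n st st1 le1.
by rewrite mulSn (leq_trans le1) // leq_add2l IHn //; lia.
Qed.

Definition rank_state m a b := form_state m a b /\ \rank (W ^+ m) = (a * b)%N.

Lemma rank_stateC m a b : rank_state m a b -> rank_state m b a.
Proof. by case=> /form_stateC st rk; split=> //; rewrite (mulnC b). Qed.

(** The step bounds the new rank from below by the new product, and [form_state_rank] bounds it from
    above. *)
Lemma rank_state_step m a b : rank_state m a b -> (a <= b)%N -> (0 < b)%N ->
  rank_state m.+1 a b.-1 \/ (0 < a)%N /\ rank_state m.+1 a.-1 b.
Proof.
case=> st rk le_ab b_gt0.
have [//||[st1 le1]|[a_gt0 st1 le1]] := form_state_step st; first by [].
  left; split=> //; apply/eqP; rewrite eqn_leq form_state_rank //=.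
  by case: b b_gt0 rk le1 {st st1 le_ab} => // b _ ->; rewrite mulnS leq_add2l.
right; split=> //; split=> //; apply/eqP; rewrite eqn_leq form_state_rank //=.
by case: a a_gt0 rk le1 {st st1 le_ab} => // a _ ->; rewrite mulSn leq_add2l.
Qed.

Lemma rank_state0 : rank_state 0 r s.
Proof.
split; last by rewrite expr0 mxrank1.
exists 'X^r, 1; split; rewrite ?coprimep1 ?size_polyXn ?size_poly1 ?eqxx //=.
- by rewrite leqnn.
- exact: annih_Xr.
- exact: annih_ys.
Qed.

(** Since [u^r] is not divisible by [W], the first step can be made to lower [s]. This fixes the
    number of parts at [r] and starts the descent to the diagonal. *)
Lemma rank_state1 : (r <= s)%N -> rank_state 1 r s.-1.
Proof.
move=> le_rs; have nz : ('X^r : {poly F}).[-1] != 0.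
  by rewrite hornerXn expf_neq0 // oppr_eq0 oner_eq0.
have sX : (size ('X^r : {poly F}) <= r.+1)%N by rewrite size_polyXn.
have le1 := rank_step sX annih_Xr nz.
have st1 : form_state 1 r s.-1.
  have es : s.-1.+1 = s by rewrite prednK.
  apply: (@form_state_reduce 0 r s.-1 'X^r 1); rewrite ?es //.
  - exact: coprimep1.
  - by rewrite size_poly1.
  - by rewrite size_polyXn eqxx.
  - exact: annih_Xr.
  - exact: annih_ys.
split=> //; apply/eqP; rewrite eqn_leq form_state_rank //=.
rewrite -(leq_add2l r) -mulnS (leq_trans _ le1) // expr0 mxrank1.
by rewrite prednK.
Qed.

End TensorForms.

(** * Partitions with staircase rank sequences *)

Section DeviationLists.
Variable r : nat.

Definition next_deviations (T : seq (seq (seq int))) (n : nat) :=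
  flatten [seq [seq l ++ nseq (n - q) (r%:Z - n%:Z - q%:Z)%R | l <- nth [::] T q]
          | q <- iota 0 n].

(** All earlier lists are stored, because the list for [n] draws on every [q < n]: [q] is the next
    diagonal point after [n]. *)
Fixpoint deviation_table n :=
  if n is m.+1 then
    let T := deviation_table m in rcons T (next_deviations T n)
  else [:: [:: [::]]].

Definition deviations n := nth [::] (deviation_table n) n.

Lemma size_deviation_table n : size (deviation_table n) = n.+1.
Proof. by elim: n => //= n IHn; rewrite size_rcons IHn. Qed.

Lemma nth_deviation_table n q :
  q <= n -> nth [::] (deviation_table n) q = deviations q.
Proof.
elim: n => [|n IHn]; first by rewrite leqn0 => /eqP->.
rewrite leq_eqVlt => /predU1P[->//|lt_qn] /=.
by rewrite nth_rcons size_deviation_table lt_qn IHn.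
Qed.

Lemma deviationsE n : 0 < n ->
  deviations n =
  flatten [seq [seq l ++ nseq (n - q) (r%:Z - n%:Z - q%:Z)%R | l <- deviations q]
          | q <- iota 0 n].
Proof.
case: n => // n _; rewrite {1}/deviations.
rewrite -[deviation_table n.+1]/(rcons _ (next_deviations (deviation_table n) n.+1)).
rewrite nth_rcons size_deviation_table ltnn eqxx.
apply: (congr1 flatten); apply/eq_in_map => q; rewrite mem_iota => /andP[_ lt_q].
by rewrite nth_deviation_table.
Qed.

(** Each new list extends every earlier vector once, so the running total doubles. *)
Lemma sum_size_deviations n : \sum_(0 <= q < n.+1) size (deviations q) = 2 ^ n.
Proof.
elim: n => [|n IHn]; first by rewrite big_nat1.
rewrite big_nat_recr //= IHn deviationsE // size_flatten /shape -map_comp.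
rewrite sumnE big_map -[iota 0 n.+1]/(index_iota 0 n.+1).
under [X in _ + X]eq_bigr do rewrite /= size_map.
by rewrite IHn expnS mul2n addnn.
Qed.

Lemma size_deviations n : 0 < n -> size (deviations n) = 2 ^ n.-1.
Proof.
case: n => // n _; have := sum_size_deviations n.+1.
rewrite big_nat_recr //= sum_size_deviations expnS mul2n -addnn.
by move/addnI.
Qed.

End DeviationLists.

(** * Reading the parts off the path of degree pairs *)

Section Staircase.

Variable lam : seq nat.
Hypothesis lam_sorted : sorted geq lam.

Definition excess t := \sum_(x <- lam) (x - t).
Definition parts_gt t := count (fun x => t < x) lam.

Lemma excessS t : excess t = parts_gt t + excess t.+1.
Proof.
rewrite /excess /parts_gt -sum1_count [X in X + _]big_mkcond -big_split /=.
by apply: eq_bigr => x _; case: ltnP => ? /=; lia.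
Qed.

Lemma parts_gt_anti t t' : t <= t' -> parts_gt t' <= parts_gt t.
Proof. by move=> le; apply: sub_count => x /=; apply: leq_ltn_trans. Qed.

Lemma ltn_parts_gt i t : (i < parts_gt t) = (t < nth 0 lam i).
Proof.
rewrite /parts_gt; elim: lam lam_sorted i => [|x l IHl] sl i.
  by rewrite nth_nil.
have sl' : sorted geq l by apply: path_sorted sl.
have lex : {in l, forall y, y <= x}.
  by apply/allP; apply: order_path_min sl => ? ? ? /[swap]; apply: leq_trans.
rewrite /=; case: (ltnP t x) => [lt_tx|le_xt]; first by case: i => [|i] //=; apply: IHl.
rewrite add0n (_ : count _ _ = 0) ?ltn0.
  case: i => [|i] /=; first by rewrite ltnNge le_xt.
  apply/esym/negbTE; rewrite -leqNgt; have [lt_il|?] := ltnP i (size l).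
    by apply: leq_trans (lex _ (mem_nth 0 lt_il)) le_xt.
  by rewrite nth_default.
apply/eqP; rewrite -leqn0 leqNgt -has_count; apply/hasPn=> y /lex le_yx.
by rewrite -leqNgt (leq_trans le_yx).
Qed.

(** An abstraction of [rank_state]: only the symmetry, the product formula and the step alternative
    matter for the combinatorics. *)
Variable state : nat -> nat -> nat -> Prop.
Hypothesis stateC : forall t a b, state t a b -> state t b a.
Hypothesis state_excess : forall t a b, state t a b -> excess t = a * b.
Hypothesis state_step : forall t a b, state t a b -> a <= b -> 0 < b ->
  state t.+1 a b.-1 \/ 0 < a /\ state t.+1 a.-1 b.

Lemma parts_gt_stepr t a b : state t a b.+1 -> state t.+1 a b -> parts_gt t = a.
Proof.
move=> /state_excess E /state_excess E1; have := excessS t.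
rewrite E E1 mulnS; lia.
Qed.

Lemma parts_gt_stepl t a b : state t a.+1 b -> state t.+1 a b -> parts_gt t = b.
Proof. by move=> /stateC st /stateC; apply: parts_gt_stepr. Qed.

(* Once the larger coordinate starts to drop it drops down to the diagonal:
   otherwise [parts_gt] would increase. *)
Lemma descend t q d : state t q (q + d).+1 -> state t.+1 q (q + d) ->
  state (t + d.+1) q q /\
  forall t', t <= t' < t + d.+1 -> parts_gt t' = q.
Proof.
elim: d t => [|d IHd] t st st1.
  rewrite addn0 in st1; rewrite addn1; split=> // t' rt'.
  by rewrite (_ : t' = t) ?(parts_gt_stepr st) ?addn0 //; lia.
have cq := parts_gt_stepr st st1.
have [||st2|[a_gt0 st2]] := state_step st1; try lia.
  rewrite addnS in st1; rewrite addnS /= in st2.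
  have [stq cnt] := IHd _ st1 st2; rewrite addnS -addSn; split=> // t' rt'.
  by have [->|ne] := eqVneq t' t; last by apply: cnt; lia.
case: q {IHd} st st1 cq a_gt0 st2 => // q _ st1 cq _ st2.
have := parts_gt_anti (leqnSn t); rewrite cq (parts_gt_stepl st1 st2); lia.
Qed.

Lemma diagonal_run t n : 0 < n -> state t n n ->
  exists2 q, q < n & [/\ state (t + (n - q).*2) q q,
    (forall t', t <= t' < t + (n - q) -> parts_gt t' = n) &
    parts_gt (t + (n - q)) = q].
Proof.
case: n => // n _ st.
have st1 : state t.+1 n n.+1.
  by have [| |/stateC|[]] := state_step st.
have c1 := parts_gt_stepl st st1.
(* After [j + 1] steps only one coordinate has dropped, to [m]. The value of [m] at which the other
   one first drops is the required [q]; at [m = 0] it has no choice. *)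
suff climb j m : j + m = n -> state (t + j.+1) m n.+1 ->
    (forall t', t <= t' < t + j.+1 -> parts_gt t' = n.+1) ->
    exists2 q, q < n.+1 & [/\ state (t + (n.+1 - q).*2) q q,
      (forall t', t <= t' < t + (n.+1 - q) -> parts_gt t' = n.+1) &
      parts_gt (t + (n.+1 - q)) = q].
  apply: (climb 0 n) => //; first by rewrite addn1.
  by move=> t' rt'; rewrite (_ : t' = t) //; lia.
elim: m j => [|m IHm] j ejm stj cj.
  rewrite addn0 in ejm; have [||stj1|[]] // := state_step stj.
  have [||stq cq] := @descend (t + j.+1) 0 n; rewrite ?add0n //.
  exists 0 => //; rewrite subn0 -addnn addnA -{1 3 5}ejm.
  by split=> //; rewrite ?cq ?ejm; try lia; move=> t' ?; rewrite cj; lia.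
have [||stj1|[_ stj1]] := state_step stj; try lia.
  exists m.+1; first by lia.
  have en : n.+1 - m.+1 = j.+1 by lia.
  have en1 : n.+1 = (m.+1 + j).+1 by lia.
  rewrite en; rewrite en1 /= in stj stj1.
  have [stq cq] := descend stj stj1.
  rewrite -addnn addnA; split=> //; apply: cq; lia.
rewrite -addnS /= in stj1; apply: (IHm j.+1 _ stj1); first by lia.
move=> t' rt'; have [lt_t'|ge_t'] := ltnP t' (t + j.+1); first by apply: cj; lia.
rewrite (_ : t' = t + j.+1); first by apply: parts_gt_stepl stj _; rewrite -addnS.
lia.
Qed.


Lemma take_diagonal_run t n q : q < n -> n <= size lam ->
  (forall t', t <= t' < t + (n - q) -> parts_gt t' = n) ->
  parts_gt (t + (n - q)) = q ->
  take n lam = take q lam ++ nseq (n - q) (t + (n - q)).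
Proof.
move=> lt_qn le_n cn cq; rewrite -{1}(subnKC (ltnW lt_qn)) takeD; congr (_ ++ _).
have sz : size (take (n - q) (drop q lam)) = n - q.
  by rewrite size_take_min size_drop; lia.
apply: (@eq_from_nth _ 0); first by rewrite sz size_nseq.
rewrite sz => i lt_i; rewrite nth_take // nth_drop nth_nseq lt_i.
(* The part at index [q + i] exceeds the last time at which [n] parts remain, but not the next time,
   when only [q] do; this pins down its value. *)
have := ltn_parts_gt (q + i) (t + (n - q)).-1; rewrite cn; last by lia.
have := ltn_parts_gt (q + i) (t + (n - q)); rewrite cq; lia.
Qed.

Variables r s : nat.

(** Each step lowers the coordinate sum by 1, so time is [r + s - 2n] at [(n, n)]. The parts
    [t + (n - q)] then deviate from [s] by [r - n - q], free of [s]. *)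
Lemma diagonal_deviation t n : t + n.*2 = r + s -> state t n n ->
  deviation s (take n lam) \in deviations r n.
Proof.
have [N lt_nN] := ubnP n; elim: N => // N IHN in n t lt_nN *.
move=> et st; have [n0|n_gt0] := posnP n; first by rewrite n0 take0.
have [q lt_qn [stq cn cq]] := diagonal_run n_gt0 st.
have le_n : n <= size lam.
  by rewrite -(cn t) ?count_size //; lia.
rewrite (take_diagonal_run lt_qn le_n cn cq) deviationsE //.
apply/flattenP; exists [seq l ++ nseq (n - q) (r%:Z - n%:Z - q%:Z)%R
  | l <- deviations r q]; first by apply/mapP; exists q; rewrite ?mem_iota.
rewrite /deviation map_cat; apply/mapP; exists (deviation s (take q lam)).
  by apply: IHN stq; lia.
by rewrite map_nseq; congr (_ ++ nseq _ _); lia.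
Qed.

Lemma staircase_deviation : 0 < r -> r <= s -> all (fun x => 0 < x) lam ->
  state 0 r s -> state 1 r s.-1 -> deviation s lam \in deviations r r.
Proof.
move=> r_gt0 le_rs lam_gt0 st0 st1.
have c0 : parts_gt 0 = r.
  by apply: parts_gt_stepr _ st1; rewrite prednK // (leq_trans r_gt0).
have sz : size lam = r by rewrite -c0; apply/esym/eqP; rewrite -all_count.
rewrite -{1}(take_size lam) sz; apply: (@diagonal_deviation (s - r)); first by lia.
(* For [s = r] the path starts on the diagonal; otherwise [descend] brings it to [(r, r)] at time
   [s - r]. *)
have [e_rs|lt_rs] := eqVneq s r; first by rewrite e_rs subnn in st0 *.
have es : s = (r + (s - r).-1).+1 by lia.
have [||+ _] := @descend 0 r (s - r).-1; rewrite -?es //.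
  by rewrite (_ : r + (s - r).-1 = s.-1) //; lia.
by rewrite prednK //; lia.
Qed.

End Staircase.

(* The set { eps(r,s,p) : s >= r, p prime } has at most 2^(r-1) elements:
   it is contained in a list of length at most 2^(r-1). *)
Theorem theorem6 (r : nat) (hr : (1 <= r)%N) :
  exists L : seq (seq int),
    (size L <= 2 ^ (r - 1))%N /\
    (forall (s p : nat) (lam : seq nat),
        (r <= s)%N -> prime p -> is_lambda r s p lam ->
        deviation s lam \in L).
Proof.
exists (deviations r r); split; first by rewrite size_deviations // subn1.
move=> s p lam le_rs _ [lam_sorted lam_gt0 lam_sum sim].
have s_gt0 : 0 < s by apply: leq_trans hr le_rs.
apply: (@staircase_deviation lam lam_sorted (rank_state 'F_p r s)) => //.
- exact: rank_stateC.
- by move=> t a b [_ <-]; rewrite (rank_similar_pow t sim) rank_jordan_sum.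
- exact: rank_state_step.
- exact: rank_state0.
- exact: rank_state1.
Qed.
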